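(* Let $R$ be a commutative ring with identity and $S$ a multiplicative subset of $R$. Assume that $R$ is uniformly $S$-Boolean with respect to some $s\in S$ with $s^2=s$. If $I$ is an ideal of $R$ disjoint from $S$, then $$ s\cdot\bigcap_{\substack{M\supseteq I\\ M\in\mathrm{Max}_S(R)}} M\;\subseteq\; I\;\subseteq\;\bigcap_{\substack{M\supseteq I\\ M\in\mathrm{Max}_S(R)}} M, $$ where $\mathrm{Max}_S(R)$ denotes the set of all $S$-maximal ideals of $R$.
   Context: A multiplicative subset contains $1$ and is closed under multiplication. $R$ is uniformly $S$-Boolean with respect to $s\in S$ if every non-idempotent element $a\in R$ satisfies $sa=a^2$. An ideal $M$ of $R$ is $S$-maximal if $M\cap S=\emptyset$ and there exists $t\in S$ such that for every ideal $K\supseteq M$ of $R$, either $tK\subseteq M$ or $K\cap S\neq\emptyset$. *)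

(* Defs.v *)
From mathcomp Require Import all_boot all_algebra.
From mathcomp Require Import boolp classical_sets.

Set Implicit Arguments.
Unset Strict Implicit.
Unset Printing Implicit Defensive.

Import GRing.Theory.

Local Open Scope classical_set_scope.
Local Open Scope ring_scope.

Section SBoolean.
Context {R : comPzRingType}.
Implicit Types (S I M K : set R) (s : R).

Definition multiplicative_subset S : Prop := GRing.mulr_closed (mem S).

(* Ideals are the R-submodules of the regular module R^o. The whole ring is
   allowed, unlike with [idealr_closed], which requires [1 \notin I]. *)
Definition is_ideal I : Prop := GRing.submod_closed (mem (I : set R^o)).

Definition uniformly_S_Boolean S s : Prop :=
  s \in S /\ forall a : R, a ^+ 2 <> a -> s * a = a ^+ 2.

Definition S_maximal S M : Prop :=
  [/\ is_ideal M, M `&` S = set0 &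
      exists2 t, t \in S &
        forall K, is_ideal K -> M `<=` K ->
          *%R t @` K `<=` M \/ K `&` S !=set0].

Definition Max S : set (set R) := [set M | S_maximal S M].

End SBoolean.

(* Main.v *)
Require Import Defs.
From mathcomp Require Import all_boot all_algebra.
From mathcomp Require Import boolp classical_sets.

Set Implicit Arguments.
Unset Strict Implicit.
Unset Printing Implicit Defensive.

Import GRing.Theory.

Local Open Scope classical_set_scope.
Local Open Scope ring_scope.

(** For [x] in [R] the element [e := s * x] is idempotent and [s * e = e]. If
    [e] is not in [I], Zorn's lemma gives an ideal [M] containing [I] and
    maximal among those avoiding [S] and [e]. This [M] is [S]-maximal. Indeed
    [e * (s - e) = 0], so no ideal generated by [M] and [s - e] can contain [e]
    unless [M] does. Hence either [s - e \in M], and then an ideal [K] above [M]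
    and disjoint from [S] cannot contain [e] (it would contain [s]), so [K = M];
    or that ideal contains some [u \in S], whence [e * u \in M], and then [u]
    maps every ideal above [M] and disjoint from [S] into [M]. Thus [x], whose
    multiple [e] lies outside [M], is not in the intersection. *)

Lemma is_idealP (R : comPzRingType) (I : set R) :
  is_ideal I <-> I 0 /\ forall a x y : R, I x -> I y -> I (a * x + y).
Proof.
split=> [[I0 Ilin]|[I0 Ilin]]; split.
- by move: I0; rewrite inE.
- by move=> a x y Ix Iy; have := Ilin a x y; rewrite !inE; apply.
- by rewrite inE.
- by move=> a x y; rewrite !inE; apply: Ilin.
Qed.

Section Ideals.
Variable R : comPzRingType.
Implicit Types (I M K A : set R) (F : set (set R)).

Lemma is_ideal_mull I (a x : R) : is_ideal I -> I x -> I (a * x).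
Proof. by case/is_idealP=> I0 Ilin Ix; rewrite -[_ * _]addr0; apply: Ilin. Qed.

Lemma is_ideal_bigcup F : F !=set0 -> F `<=` @is_ideal R ->
  total_on F subset -> is_ideal (\bigcup_(J in F) J).
Proof.
move=> [J FJ] Fid Ftot; apply/is_idealP; split.
  by exists J => //; case/is_idealP: (Fid _ FJ).
move=> a x y [X FX Xx] [Y FY Yy].
have [XY|YX] := Ftot X Y FX FY.
- exists Y => //; case/is_idealP: (Fid _ FY) => _; apply=> //; exact: XY.
- exists X => //; case/is_idealP: (Fid _ FX) => _; apply=> //; exact: YX.
Qed.

Definition adjoin I (y : R) : set R :=
  [set z | exists r m, I m /\ z = r * y + m].

Lemma adjoin_ideal I y : is_ideal I -> is_ideal (adjoin I y).
Proof.
case/is_idealP=> I0 Ilin; apply/is_idealP; split.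
  by exists 0, 0; rewrite mul0r addr0.
move=> a _ _ [r [m [Im ->]]] [r' [m' [Im' ->]]].
exists (a * r + r'), (a * m + m'); split; first exact: Ilin.
by rewrite mulrDr mulrDl mulrA addrACA.
Qed.

Lemma sub_adjoin I y : I `<=` adjoin I y.
Proof. by move=> m Im; exists 0, m; rewrite mul0r add0r. Qed.

Lemma adjoin_gen I y : is_ideal I -> adjoin I y y.
Proof. by case/is_idealP=> I0 _; exists 1, 0; rewrite mul1r addr0. Qed.

Lemma adjoin_sub I K y : is_ideal K -> I `<=` K -> K y -> adjoin I y `<=` K.
Proof.
by case/is_idealP=> K0 Klin IK Ky _ [r [m [Im ->]]]; apply: Klin => //; apply: IK.
Qed.

Definition maximal_avoiding A M : Prop :=
  [/\ is_ideal M, M `&` A = set0 &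
      forall K, is_ideal K -> M `<=` K -> K `&` A = set0 -> K `<=` M].

Lemma exists_maximal_avoiding A I : is_ideal I -> I `&` A = set0 ->
  exists2 M, maximal_avoiding A M & I `<=` M.
Proof.
move=> Iid IA.
(* Adding [I] to every member makes the union of the empty chain admissible. *)
pose P := [set J | is_ideal (I `|` J) /\ (I `|` J) `&` A = set0].
have [|J [[Mid MA] Jmax]] := @Zorn_bigcup R P.
  move=> F FP Ftot.
  rewrite /P /=; pose G := I |` [set I `|` J | J in F].
  have -> : I `|` \bigcup_(J in F) J = \bigcup_(J in G) J.
    apply/seteqP; split=> [x [Ix|[J FJ Jx]]|x [_ [->|[J FJ <-]]]].
    - by exists I => //; left.
    - by exists (I `|` J); [right; exists J | right].
    - by left.
    - by case=> [Ix|Jx]; [left | right; exists J].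
  split.
    apply: is_ideal_bigcup.
    - by exists I; left.
    - by move=> _ [->//|[J FJ <-]]; case: (FP _ FJ).
    - move=> _ _ [->|[X FX <-]] [->|[Y FY <-]].
      + by left.
      + by left=> x; left.
      + by right=> x; left.
      + by have [XY|YX] := Ftot X Y FX FY; [left|right]; apply: setUS.
  rewrite -subset0 => x [[_ [->|[J FJ <-]]]] Jx Ax.
  - by rewrite -IA; split.
  - by case: (FP _ FJ) => _ <-; split.
(* [J] itself need not contain [I], so the ideal sought is the union. A larger ideal [K] avoiding
   [A] absorbs [I], hence lies in [P] and cannot strictly contain [J]. *)
exists (I `|` J); last exact: subsetUl.
split=> // K Kid MK KA.
have IK : I `|` K = K by apply/setUidPr => x Ix; apply: MK; left.
apply: contrapT => KM; apply: (Jmax K); last by rewrite /P /= IK.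
split; first by move=> x Jx; apply: MK; right.
by move=> KJ; apply: KM => x /KJ; right.
Qed.

Lemma maximal_avoiding_S_maximal S M (s e : R) :
  s \in S -> e * e = e -> s * e = e ->
  maximal_avoiding (e |` S) M -> S_maximal S M.
Proof.
move=> Ss ee se [Mid MeS Mmax].
have Me : ~ M e by move=> Me; have : (M `&` (e |` S)) e; [split; [|left]|rewrite MeS].
have MS : M `&` S = set0.
  by rewrite -subset0 => x [Mx Sx]; rewrite -MeS; split=> //; right.
(* By maximality of [M], such a [K] must meet [S] with [e] added, and only [e] is left. *)
have meetP K : is_ideal K -> M `<=` K -> ~ K `<=` M -> K `&` S = set0 -> K e.
  move=> Kid MK KM KS; apply: contrapT => Ke; apply: KM; apply: Mmax => //.
  rewrite -subset0 => x [Kx [xe|Sx]]; first by apply: Ke; rewrite -xe.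
  by rewrite -KS.
(* Multiplying [e = r * y + m] by [e] kills the term in [y] and leaves [e = e * m]. *)
have annihilated y : e * y = 0 -> ~ adjoin M y e.
  move=> ey0 [r [m [Mm eE]]]; apply: Me.
  suff -> : e = e * m by apply: is_ideal_mull.
  by rewrite -{1}ee {2}eE mulrDr mulrCA ey0 mulr0 add0r.
split=> //.
have [seM|seM] := pselect (M (s - e)).
  (* A [K] missing [S] but not inside [M] would contain [e] and [s - e], hence their sum [s]. *)
  exists s => // K Kid MK.
  have [KS|] := eqVneq (K `&` S) set0; [left|by move/set0P; right].
  suff KM : K `<=` M by move=> _ [k Kk <-]; apply: is_ideal_mull => //; apply: KM.
  apply: contrapT => KM; have Ke := meetP K Kid MK KM KS.
  have : (K `&` S) s; last by rewrite KS.
  split; last by rewrite inE in Ss.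
  case/is_idealP: Kid => _ Klin; rewrite -(subrK e s) -[s - e]mul1r.
  by apply: Klin => //; apply: MK.
have ese0 : e * (s - e) = 0 by rewrite mulrBr ee mulrC se subrr.
have NM : ~ adjoin M (s - e) `<=` M by move=> /(_ _ (adjoin_gen (s - e) Mid)).
(* If this ideal missed [S], [meetP] would put [e] in it, against [annihilated]. *)
have [u [[r [m [Mm uE]]] Su]] : adjoin M (s - e) `&` S !=set0.
  apply/set0P/eqP => NS; apply: (annihilated _ ese0).
  by apply: meetP => //; [exact: adjoin_ideal | exact: sub_adjoin].
have Meu : M (e * u).
  by rewrite uE mulrDr mulrCA ese0 mulr0 add0r; apply: is_ideal_mull.
exists u; first by rewrite inE.
move=> K Kid MK.
have [KS|] := eqVneq (K `&` S) set0; [left|by move/set0P; right].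
move=> _ [k Kk <-]; apply: contrapT => Muk.
(* Lying inside [K], this ideal misses [S]; being strictly above [M], it must contain [e]. *)
have NK : adjoin M (u * k) `<=` K.
  by apply: adjoin_sub => //; apply: is_ideal_mull.
have [||||r' [m' [Mm' eE]]] := meetP (adjoin M (u * k)).
- exact: adjoin_ideal.
- exact: sub_adjoin.
- by move=> /(_ _ (adjoin_gen (u * k) Mid)).
- by rewrite -subset0 -KS; apply: setSI.
(* Multiplying [e = r' * (u * k) + m'] by [e] brings out the factor [e * u], already known to be in
   [M]. *)
have eE' : e = r' * k * (e * u) + e * m'.
  by rewrite -{1}ee {2}eE mulrDr mulrCA -mulrA (mulrC k) (mulrA e).
apply: Me; rewrite eE'; case/is_idealP: (Mid) => _; apply=> //.
exact: is_ideal_mull.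
Qed.

End Ideals.

(** Since [s] is idempotent, the square is [s * x ^+ 2]. Either [x ^+ 2 = x], or [x ^+ 2 = s * x]
    and the extra factor [s] is absorbed. *)
Lemma uniformly_S_Boolean_idem (R : comPzRingType) (S : set R) (s x : R) :
  uniformly_S_Boolean S s -> s ^+ 2 = s -> (s * x) ^+ 2 = s * x.
Proof.
move=> [_ Sb] ss; rewrite exprMn ss.
have [->//|/Sb <-] := pselect (x ^+ 2 = x).
by rewrite mulrA -expr2 ss.
Qed.

Theorem theorem3p13 (R : comPzRingType) (S : set R) (s : R) (I : set R)
    (S_mult : multiplicative_subset S)
    (R_SBool : uniformly_S_Boolean S s)
    (s_idem : s ^+ 2 = s)
    (I_ideal : is_ideal I)
    (I_disj : I `&` S = set0) :
  *%R s @` (\bigcap_(M in [set M | Max S M /\ I `<=` M]) M) `<=` I /\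
  I `<=` \bigcap_(M in [set M | Max S M /\ I `<=` M]) M.
Proof.
split; last by move=> x Ix M [_]; apply.
move=> _ [x xM <-]; apply: contrapT => Ie.
have [||M Mmax IM] := @exists_maximal_avoiding _ (s * x |` S) I => //.
  by rewrite -subset0 => y [Iy [ye|Sy]]; [apply: Ie; rewrite -ye | rewrite -I_disj].
have [Ss _] := R_SBool.
have MS : S_maximal S M.
  apply: (maximal_avoiding_S_maximal Ss _ _ Mmax).
  - by rewrite -expr2 (uniformly_S_Boolean_idem _ R_SBool).
  - by rewrite mulrA -expr2 s_idem.
have Me : M (s * x).
  by case: (MS) => Mid _ _; apply: is_ideal_mull => //; apply: xM.
case: Mmax => _ MeS _.
by have : (M `&` (s * x |` S)) (s * x); [split; [|left] | rewrite MeS].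
Qed.
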